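(* Let $p$ be a prime, $\zeta_p$ a primitive $p$-th root of unity, $k=\mathbb{Q}_p(\zeta_p)$, $O_k=\mathbb{Z}_p[\zeta_p]$ its ring of integers, and $m_k=\pi O_k$ its maximal ideal, where $\pi$ is a uniformizer. Let $L(x)=\log_p(1+x)=\sum_{n\ge 1}(-1)^{n-1}\frac{x^n}{n}$ be the $p$-adic logarithm induced by the one-dimensional multiplicative formal group law $M(x,y)=x+y+xy$. Then the image of $1+m_k$ under the $p$-adic logarithm is $m_k^2$, i.e. $\{\log_p(1+x): x\in m_k\}=m_k^2$, and $m_k^2$ is a subgroup of the group $m_k$ under the formal group law $M$ (with group operation $\alpha+_M\beta=M(\alpha,\beta)=\alpha+\beta+\alpha\beta$).
   Context: A formal group law over a ring $R$ is a power series $F(X,Y)\in R[[X,Y]]$ with $F(X,Y)=X+Y+$ (higher degree terms) and $F(X,F(Y,Z))=F(F(X,Y),Z)$. For the multiplicative formal group law $M(x,y)=x+y+xy$, the normalized invariant differential is $\omega(x)=\frac{dx}{1+x}$, and its associated formal logarithm is $\log_M(x)=\int_0^x\frac{dt}{1+t}=x-\frac{x^2}{2}+\frac{x^3}{3}-\cdots=\log_p(1+x)$, which satisfies $\log_M(M(x,y))=\log_M(x)+\log_M(y)$ and converges on $m_k$. The maximal ideal $m_k$ is a group under $\alpha+_M\beta=M(\alpha,\beta)$. *)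

(* Defs.v *)
From HB Require Import structures.
From mathcomp Require Import all_boot all_order all_algebra all_field.
From mathcomp Require Import boolp classical_sets.

Set Implicit Arguments.
Unset Strict Implicit.
Unset Printing Implicit Defensive.

Import GRing.Theory.

Local Open Scope ring_scope.

(* The inverse limit of the rings Z/p^(n+1)Z; the exponent is shifted because
   'Z_1 denotes Z/2Z. The component of index n is the residue mod p^(n+1). *)
Definition padic_compatible (p : nat) (x : forall n, 'Z_(p ^ n.+1)) : Prop :=
  forall n, x n = (x n.+1 : nat)%:R.

(* Indexed by a proof of primality so that the field structure of the fraction
   field is canonical. *)
Record padic_int (p : nat) (p_pr : prime p) := PadicInt {
  residue : forall n, 'Z_(p ^ n.+1);
  residueP : padic_compatible residue
}.

HB.instance Definition _ (p : nat) (p_pr : prime p) :=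
  gen_eqMixin (padic_int p_pr).
HB.instance Definition _ (p : nat) (p_pr : prime p) :=
  gen_choiceMixin (padic_int p_pr).

Section PadicIntegersTheory.

Variables (p : nat) (p_pr : prime p).

Local Notation Z := (padic_int p_pr).
Implicit Types x y z : Z.

Lemma padic_intP x y : (forall n, residue x n = residue y n) -> x = y.
Proof.
case: x y => [x xP] [y yP] /= xy.
have {}xy : x = y by apply: functional_extensionality_dep.
by subst y; congr PadicInt; apply: Prop_irrelevance.
Qed.

Lemma pX_gt1 n : (1 < p ^ n.+1)%N.
Proof. by rewrite -(exp1n n.+1) ltn_exp2r // prime_gt1. Qed.

Lemma Zp_eqP n (a b : nat) :
  (a%:R == b%:R :> 'Z_(p ^ n.+1)) = (a == b %[mod p ^ n.+1]).
Proof. by rewrite -val_eqE /= !val_Zp_nat ?pX_gt1. Qed.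

Lemma natr_modn n (a : nat) :
  ((a %% (Zp_trunc (p ^ n.+2)).+2)%:R = a%:R :> 'Z_(p ^ n.+1)).
Proof.
by apply/eqP; rewrite Zp_eqP (Zp_cast (pX_gt1 n.+1)) modn_dvdm // dvdn_exp2l.
Qed.

Lemma compatible_nat a : padic_compatible (fun n => (a%:R : 'Z_(p ^ n.+1))).
Proof. by move=> n; rewrite [X in nat_of_ord X]Zp_nat natr_modn. Qed.

Lemma compatible_add x y :
  padic_compatible (fun n => residue x n + residue y n).
Proof.
by move=> n; rewrite (residueP x) (residueP y) -natrD -natr_modn.
Qed.

Lemma compatible_mul x y :
  padic_compatible (fun n => residue x n * residue y n).
Proof.
by move=> n; rewrite (residueP x) (residueP y) -natrM -natr_modn.
Qed.

Lemma compatible_opp x : padic_compatible (fun n => - residue x n).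
Proof.
move=> n; apply/eqP; rewrite eq_sym -subr_eq0 opprK (residueP x n) -natrD.
rewrite -natr_modn.
by have /(congr1 (@nat_of_ord _)) /= -> := addNr (residue x n.+1).
Qed.

Definition padic0 : Z := PadicInt p_pr (compatible_nat 0).
Definition padic1 : Z := PadicInt p_pr (compatible_nat 1).
Definition padic_add x y : Z := PadicInt p_pr (compatible_add x y).
Definition padic_mul x y : Z := PadicInt p_pr (compatible_mul x y).
Definition padic_opp x : Z := PadicInt p_pr (compatible_opp x).

Lemma padic_addA : associative padic_add.
Proof. by move=> x y z; apply: padic_intP => n /=; rewrite addrA. Qed.
Lemma padic_addC : commutative padic_add.
Proof. by move=> x y; apply: padic_intP => n /=; rewrite addrC. Qed.
Lemma padic_add0 : left_id padic0 padic_add.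
Proof. by move=> x; apply: padic_intP => n /=; rewrite add0r. Qed.
Lemma padic_addN : left_inverse padic0 padic_opp padic_add.
Proof. by move=> x; apply: padic_intP => n /=; rewrite addNr. Qed.

HB.instance Definition _ :=
  GRing.isZmodule.Build Z padic_addA padic_addC padic_add0 padic_addN.

Lemma padic_mulA : associative padic_mul.
Proof. by move=> x y z; apply: padic_intP => n /=; rewrite mulrA. Qed.
Lemma padic_mulC : commutative padic_mul.
Proof. by move=> x y; apply: padic_intP => n /=; rewrite mulrC. Qed.
Lemma padic_mul1 : left_id padic1 padic_mul.
Proof. by move=> x; apply: padic_intP => n /=; rewrite mul1r. Qed.
Lemma padic_mulDl : left_distributive padic_mul padic_add.
Proof. by move=> x y z; apply: padic_intP => n /=; rewrite mulrDl. Qed.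
Lemma padic1_neq0 : padic1 != 0 :> Z.
Proof.
apply/eqP => /(congr1 (fun x : Z => residue x 0)) /= /eqP.
by rewrite oner_eq0.
Qed.

HB.instance Definition _ :=
  GRing.Zmodule_isComNzRing.Build Z padic_mulA padic_mulC padic_mul1
    padic_mulDl padic1_neq0.

Definition padic_unit : {pred Z} := fun x => `[< exists y, y * x = 1 >].

Definition padic_inv x : Z :=
  if pselect (exists y, y * x = 1) is left x_unit then projT1 (cid x_unit)
  else x.

Lemma padic_mulV : {in padic_unit, left_inverse 1 padic_inv *%R}.
Proof.
move=> x /asboolP x_unit; rewrite /padic_inv.
by case: pselect => // ?; case: cid.
Qed.
Lemma padic_unitP x y : y * x = 1 -> padic_unit x.
Proof. by move=> xy1; apply/asboolP; exists y. Qed.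
Lemma padic_inv_out : {in [predC padic_unit], padic_inv =1 id}.
Proof.
move=> x /negP x_nunit; rewrite /padic_inv; case: pselect => // x_unit.
by case: x_nunit; apply/asboolP.
Qed.

HB.instance Definition _ :=
  GRing.ComNzRing_hasMulInverse.Build Z padic_mulV padic_unitP padic_inv_out.

Lemma padic_residue_dvd x n m :
  (n <= m)%N -> (p ^ n.+1 %| residue x m)%N = (residue x n == 0).
Proof.
have natP (z : 'Z_(p ^ n.+1)) : z = (z : nat)%:R.
  by rewrite natr_Zp.
elim: m => [|m IHm].
  rewrite leqn0 => /eqP n0; subst n.
  by rewrite [in RHS](natP (residue x 0)) (Zp_eqP 0 _ 0%N) mod0n.
rewrite leq_eqVlt => /predU1P [En|].
  by subst n; rewrite [in RHS](natP (residue x m.+1)) (Zp_eqP m.+1 _ 0%N) mod0n.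
rewrite ltnS => le_nm; rewrite -(IHm le_nm) (residueP x m).
by rewrite val_Zp_nat ?pX_gt1 // /dvdn modn_dvdm // dvdn_exp2l.
Qed.

Lemma padic_int_integral x y : x * y = 0 -> (x == 0) || (y == 0).
Proof.
move=> xy0; apply/orP.
have nz z : z <> 0 -> exists n, residue z n != 0.
  move=> z0; apply: contrapT => /forallNP zn; apply: z0; apply: padic_intP.
  by move=> n; apply/eqP; rewrite -[_ == _]negbK; apply/negP/zn.
have [_|/eqP /nz [n xn]] := eqVneq x 0; first by left.
have [_|/eqP /nz [m ym]] := eqVneq y 0; first by right.
exfalso; set N := (n + m).+1.
have nN : (n <= N)%N by rewrite /N -addnS leq_addr.
have mN : (m <= N)%N by rewrite /N -addSn leq_addl.
have xyN0 : residue x N * residue y N = 0.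
  exact: (congr1 (fun z : Z => residue z N) xy0).
have : (p ^ N.+1 %| residue x N * residue y N)%N.
  rewrite /dvdn -(mod0n (p ^ N.+1)) -Zp_eqP natrM.
  by rewrite !natr_Zp xyN0.
have dvdF k a : (a > 0)%N -> ~~ (p ^ k.+1 %| a)%N -> (logn p a <= k)%N.
  by move=> a0; rewrite pfactor_dvdn // -ltnNge ltnS.
move: xn ym; rewrite -(padic_residue_dvd x nN) -(padic_residue_dvd y mN).
move: (residue x N : nat) (residue y N : nat) => [|a] [|b];
  rewrite ?dvdn0 //.
move=> /(dvdF n a.+1 isT) an /(dvdF m b.+1 isT) bm.
rewrite pfactor_dvdn // lognM // /N leqNgt => /negP; apply.
by rewrite ltnS (leq_trans (leq_add an bm)).
Qed.

HB.instance Definition _ :=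
  GRing.ComUnitRing_isIntegral.Build Z padic_int_integral.

End PadicIntegersTheory.

Definition padic (p : nat) (p_pr : prime p) : fieldType :=
  {fraction (padic_int p_pr)}.

Local Open Scope classical_set_scope.

Section Ideals.

Variable K : fieldType.
Implicit Types A I J : set K.

Definition is_ideal A I : Prop :=
  [/\ I `<=` A, I 0,
      forall x y, I x -> I y -> I (x + y) &
      forall a x, A a -> I x -> I (a * x)].

Definition maximal_ideal A I : Prop :=
  [/\ is_ideal A I, I <> A &
      forall J, is_ideal A J -> I `<=` J -> J = I \/ J = A].

Definition principal_ideal A (x : K) : set K := [set x * a | a in A].

Definition ideal_sqr I : set K :=
  [set z | exists n (x y : 'I_n -> K),
     [/\ forall i, I (x i), forall i, I (y i) & z = \sum_(i < n) x i * y i]].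

End Ideals.

Section Groups.

Variables (T : Type) (op : T -> T -> T).

Definition is_group (G : set T) : Prop :=
  [/\ forall x y, G x -> G y -> G (op x y),
      forall x y z, G x -> G y -> G z -> op x (op y z) = op (op x y) z &
      exists2 e, G e &
        (forall x, G x -> op e x = x /\ op x e = x) /\
        (forall x, G x -> exists2 y, G y & op y x = e /\ op x y = e)].

Definition is_subgroup (H G : set T) : Prop :=
  [/\ is_group G, is_group H & H `<=` G].

End Groups.

Definition multiplicative_fgl (R : pzRingType) (x y : R) : R := x + y + x * y.

Section PadicExtension.

Variables (p : nat) (p_pr : prime p) (k : fieldExtType (padic p_pr)).

Definition padic_int_in (a : padic_int p_pr) : k := (FracField.tofrac a)%:A.

Definition ring_of_integers : set k := [set x | integralOver padic_int_in x].

(* Convergence for the p-adic topology of k, in which the p^N O_k form a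
   neighbourhood basis of 0. *)
Definition padic_cvg (u : nat -> k) (l : k) : Prop :=
  forall N, exists n0, forall n, (n0 <= n)%N ->
    principal_ideal ring_of_integers (p%:R ^+ N) (u n - l).

Definition log_partial_sum (x : k) (n : nat) : k :=
  \sum_(1 <= i < n.+1) (-1) ^+ i.-1 * (x ^+ i / i%:R).

(* The sum of the logarithmic series in u - 1, and 0 if it diverges. *)
Definition padic_log (u : k) : k :=
  xget 0 [set l | padic_cvg (log_partial_sum (u - 1)) l].

End PadicExtension.

Arguments ring_of_integers {p p_pr} k _.

(* Main.v *)
Require Import Defs.
From HB Require Import structures.
From mathcomp Require Import all_boot all_order all_algebra all_field.
From mathcomp Require Import boolp classical_sets.
From mathcomp Require Import zify ring.

(* Put lam = zeta - 1. Dividing (1 + lam)^p = 1 by lam gives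
   lam^(p-1) = -p (1 + lam c), so lam plays the role of a uniformizer, p has
   valuation p - 1, the integral closure O of Z_p is Z_p[lam], and the maximal
   ideal is lam O. The term x^i / i of the logarithm of x in lam O lies in
   lam^2 O except for i = 1 and i = p, and the sum of these two terms does too:
   lam^(p-1) / p is -1 mod lam, and u^p = u in the residue field F_p. Hence the
   logarithm maps lam O into lam^2 O. Conversely, on lam^2 O the logarithm is
   the identity plus a contraction, so by completeness every element of
   lam^2 O is the logarithm of one of lam^2 O. *)

Set Implicit Arguments.
Unset Strict Implicit.
Unset Printing Implicit Defensive.

Import GRing.Theory.

Local Open Scope ring_scope.
Local Open Scope classical_set_scope.

(** * The ring Z_p: divisibility by p, units, convergence of series *)

Section PadicIntegers.

Variables (p : nat) (p_pr : prime p).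
Local Notation Zp := (padic_int p_pr).
Implicit Types x y : Zp.

Lemma residueD x y n : residue (x + y) n = residue x n + residue y n.
Proof. by []. Qed.

Lemma residueN x n : residue (- x) n = - residue x n.
Proof. by []. Qed.

Lemma residueM x y n : residue (x * y) n = residue x n * residue y n.
Proof. by []. Qed.

Lemma residue_natr a n : residue (a%:R : Zp) n = a%:R.
Proof. by elim: a => // a IHa; rewrite -natr1 residueD IHa -natr1. Qed.

Lemma residue_pX n m : (n < m)%N -> residue (p%:R ^+ m : Zp) n = 0.
Proof.
move=> lt_nm; rewrite -natrX residue_natr; apply/eqP.
by rewrite (Zp_eqP p_pr n _ 0) mod0n -/(dvdn _ _) dvdn_exp2l.
Qed.

Lemma padic_natr_neq0 : p%:R != 0 :> Zp.
Proof.
apply/eqP => /(congr1 (fun x => residue x 1)); rewrite residue_natr => /eqP.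
rewrite (Zp_eqP p_pr 1 _ 0) mod0n modn_small ?ltn_Pmull ?expn1 ?prime_gt1 //.
  by rewrite eqn0Ngt prime_gt0.
by rewrite prime_gt0.
Qed.

(** Division by p loses one digit: the quotient mod p^(n+1) is the residue of [x] mod p^(n+2)
    divided by p. *)
Lemma residue_eq0_dvd x : residue x 0 = 0 -> exists y, x = p%:R * y.
Proof.
move=> x0; have p_gt0 := prime_gt0 p_pr.
have dvd n : (p %| residue x n)%N.
  suff: (p ^ 1 %| residue x n)%N by [].
  by rewrite padic_residue_dvd // x0.
have cval n : (residue x n : nat) = (residue x n.+1 %% p ^ n.+1)%N.
  by rewrite {1}(residueP x n) val_Zp_nat // pX_gt1.
have yP : padic_compatible
    (fun n => ((residue x n.+1 %/ p)%:R : 'Z_(p ^ n.+1))).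
  move=> n; transitivity ((residue x n.+2 %/ p)%:R : 'Z_(p ^ n.+1)); last first.
    exact: (compatible_nat p_pr).
  apply/eqP; rewrite (Zp_eqP p_pr) cval.
  have /dvdnP[b ->] := dvd n.+2.
  by rewrite mulnK // [(p ^ n.+2)%N]expnSr -muln_modl mulnK // modn_mod.
exists (PadicInt p_pr yP); apply: padic_intP => n.
rewrite residueM residue_natr /= -natrM mulnC divnK //.
by rewrite (residueP x n).
Qed.

Lemma residue_pmul_eq0 y n :
  (residue (p%:R * y) n.+1 == 0) = (residue y n == 0).
Proof.
rewrite -(padic_residue_dvd y (leqnSn n)) residueM residue_natr.
rewrite -(natr_Zp (residue y n.+1)) -natrM (Zp_eqP p_pr _ _ 0) mod0n natr_Zp.
move: (nat_of_ord _) => a.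
by rewrite -/(dvdn _ _) [(p ^ n.+2)%N]expnS dvdn_pmul2l ?prime_gt0.
Qed.

(** A nonzero residue mod p makes every residue prime to p; uniqueness of inverses makes the
    inverses compatible. *)
Lemma padic_unit_residue x : residue x 0 != 0 -> x \is a GRing.unit.
Proof.
move=> x0.
have xu n : residue x n \is a GRing.unit.
  rewrite -(natr_Zp (residue x n)) unitZpE ?pX_gt1 //.
  rewrite coprime_sym coprime_pexpr // coprime_sym prime_coprime //.
  have -> // : (p %| residue x n)%N = (residue x 0 == 0).
  exact: (@padic_residue_dvd _ p_pr x 0 n).
have yP : padic_compatible (fun n => (residue x n)^-1).
  move=> n; apply: (mulrI (xu n)); rewrite divrr ?xu //.
  rewrite {1}(residueP x n) -natrM -(natr_modn p_pr).
  by have /(congr1 (@nat_of_ord _)) /= -> := mulrV (xu n.+1).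
apply/unitrP; exists (PadicInt p_pr yP).
by split; apply: padic_intP => n; rewrite residueM /= ?mulVr ?divrr ?xu.
Qed.

(** This turns any denominator into a power of p. As long as the residue mod p vanishes, p can be
    divided out, which lowers the index of a nonzero residue. *)
Lemma padic_int_dvd_pX x : x != 0 -> exists s y, x * y = p%:R ^+ s.
Proof.
move=> xn0.
have [n xn] : exists n, residue x n != 0.
  apply: contrapT => /forallNP x0; case/eqP: xn0; apply: padic_intP => n.
  by apply: contrapT => /eqP /x0.
elim: n x xn {xn0} => [|n IHn] x xn.
  by exists 0, x^-1; rewrite divrr // padic_unit_residue.
have [x0|] := eqVneq (residue x 0) 0; last first.
  by move=> /padic_unit_residue xu; exists 0, x^-1; rewrite divrr.
have [z Ez] := residue_eq0_dvd x0.
have [|s [y zy]] := IHn z; last by exists s.+1, y; rewrite Ez -mulrA zy exprS.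
apply: contraNneq xn => zn.
by rewrite Ez residue_pmul_eq0 zn.
Qed.

(** Completeness of Z_p, in the form used on each coordinate in [Oint_complete]. The limit mod
    p^(n+1) is read off from the first n+1 terms, since the later ones vanish there. *)
Lemma padic_int_series (a : nat -> Zp) : exists s, forall N, exists r,
  s - \sum_(j < N) p%:R ^+ j * a j = p%:R ^+ N * r.
Proof.
pose S n := \sum_(j < n) p%:R ^+ j * a j.
have SS n m : (n < m)%N -> residue (S m) n = residue (S n.+1) n.
  move=> /subnK <-; elim: (m - _)%N => [|k IHk] //.
  rewrite addSn /S big_ord_recr residueD -/(S _) IHk residueM residue_pX.
    by rewrite mul0r addr0.
  by rewrite addnS ltnS leq_addl.
have sP : padic_compatible (fun n => residue (S n.+1) n).
  by move=> n; rewrite -(SS n n.+2) // (residueP (S n.+2) n).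
have dvdX N x : (forall n, (n < N)%N -> residue x n = 0) ->
    exists r, x = p%:R ^+ N * r.
  elim: N x => [|N IHN] x x0; first by exists x; rewrite mul1r.
  have [y Ey] := residue_eq0_dvd (x0 0 isT).
  have [|r Er] := IHN y; last by exists r; rewrite Ey Er exprS mulrA.
  move=> n lt_nN; apply/eqP.
  by rewrite -residue_pmul_eq0 -Ey; apply/eqP/x0.
exists (PadicInt p_pr sP) => N; rewrite -/(S N); apply: dvdX => n lt_nN.
by rewrite residueD residueN /= (SS n N) // subrr.
Qed.

End PadicIntegers.

(** * Bounds on the p-adic valuation of i, weighted by p - 1 *)

(** As p has valuation p - 1, this gives x^i / i valuation at least 1 for x in lam O. It reduces to
    (p-1) a < p^a. *)
Lemma muln_logn_lt p i : prime p -> (0 < i)%N -> (p.-1 * logn p i < i)%N.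
Proof.
move=> p_pr i_gt0; apply: leq_trans (dvdn_leq i_gt0 (pfactor_dvdnn p i)).
have := prime_gt0 p_pr; case: p {p_pr} => // q _ /=.
elim: (logn _ i) => [|a IHa]; first by rewrite muln0 expn0.
by rewrite expnS; nia.
Qed.

(** For x in lam O this gives x^i / i valuation at least (i - p) / 2, so the terms of the logarithm
    tend to 0. *)
Lemma double_muln_logn_le p i : prime p -> (0 < i)%N ->
  ((p.-1 * logn p i).*2 <= i + p)%N.
Proof.
move=> p_pr i_gt0; have p_gt1 := prime_gt1 p_pr.
apply: (@leq_trans (p ^ logn p i + p)); last first.
  by rewrite leq_add2r dvdn_leq // pfactor_dvdnn.
case: p p_gt1 {p_pr} => [|[|q]] // _ /=.
elim: (logn _ i) => [|[|a] IHa]; first by rewrite muln0.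
  by rewrite muln1 expn1; lia.
have := ltn_expl a.+1 (isT : 1 < q.+2)%N.
by rewrite [(q.+2 ^ a.+2)%N]expnS; nia.
Qed.

(** For x in lam O, the terms x^i / i with i other than 1 and p have valuation at least 2. If p
    divides i exactly once, then i = b p with b >= 2; otherwise p^a outgrows (p-1) a. *)
Lemma muln_logn_leB2 p i : prime p -> (1 < i)%N -> i != p ->
  (p.-1 * logn p i + 2 <= i)%N.
Proof.
move=> p_pr i_gt1 ip; have p_gt1 := prime_gt1 p_pr.
have [b _ Ei] := pfactor_coprime p_pr (ltnW i_gt1).
move: Ei; case: (logn p i) => [|[|a]] Ei; first by rewrite muln0.
  move: Ei ip i_gt1; rewrite expn1 muln1 => -> ip b_gt0.
  have [|] := eqVneq b 1%N; first by move=> b1; rewrite b1 mul1n eqxx in ip.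
  by move=> b1; nia.
have : (p ^ a.+2 <= i)%N by rewrite Ei leq_pmull //; case: b Ei i_gt1 => [->|].
apply: leq_trans.
case: p p_gt1 {p_pr ip Ei} => [|[|q]] // _ /=.
elim: a => [|a IHa]; first by rewrite expnS expn1; nia.
have := ltn_expl a.+2 (isT : 1 < q.+2)%N.
by rewrite [(q.+2 ^ a.+3)%N]expnS; nia.
Qed.

(** * The logarithm over an abstract complete ring O with uniformizer lam *)

Section LocalLogarithm.

Variables (K : fieldType) (O : subringClosed K) (lam : K) (p : nat).
Hypothesis p_pr : prime p.
Hypothesis lam_O : lam \in O.
Hypothesis lamV_O : lam^-1 \notin O.
Hypothesis lam_ram :
  exists2 c, c \in O & lam ^+ p.-1 = - p%:R * (1 + lam * c).
Hypothesis unit_1D : forall c, c \in O -> (1 + lam * c)^-1 \in O.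
Hypothesis residue_nat :
  forall x, x \in O -> exists n : nat, (x - n%:R) / lam \in O.
Hypothesis sepO : forall x, (forall N, x / lam ^+ N \in O) -> x = 0.
Hypothesis completeO : forall u : nat -> K, u 0 \in O ->
  (forall n, (u n.+1 - u n) / lam ^+ n \in O) ->
  exists l, forall n, (u n - l) / lam ^+ n \in O.

(** The quotient encodes membership in lam^N O: lam is nonzero, since 0^-1 = 0 lies in O and lam^-1
    does not. *)
Definition in_pow (N : nat) (x : K) : bool := x / lam ^+ N \in O.

Definition lam_cvg (u : nat -> K) (l : K) : Prop :=
  forall N, exists n0, forall n, (n0 <= n)%N -> in_pow N (u n - l).

Definition log_sum (x : K) (n : nat) : K :=
  \sum_(1 <= i < n.+1) (-1) ^+ i.-1 * (x ^+ i / i%:R).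

Lemma lam_neq0 : lam != 0.
Proof. by apply: contraNneq lamV_O => ->; rewrite invr0 rpred0. Qed.

Lemma lamX_neq0 N : lam ^+ N != 0.
Proof. by rewrite expf_neq0 // lam_neq0. Qed.

Lemma in_powP N x :
  reflect (exists2 y, y \in O & x = lam ^+ N * y) (in_pow N x).
Proof.
apply: (iffP idP) => [xO|[y yO ->]].
  by exists (x / lam ^+ N) => //; rewrite mulrC divfK // lamX_neq0.
by rewrite /in_pow mulrAC divff ?mul1r // lamX_neq0.
Qed.

Lemma in_pow0 N : in_pow N 0.
Proof. by rewrite /in_pow mul0r rpred0. Qed.

Lemma in_powD N x y : in_pow N x -> in_pow N y -> in_pow N (x + y).
Proof. by move=> xN yN; rewrite /in_pow mulrDl rpredD. Qed.

Lemma in_powN N x : in_pow N (- x) = in_pow N x.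
Proof. by rewrite /in_pow mulNr rpredN. Qed.

Lemma in_powB N x y : in_pow N x -> in_pow N y -> in_pow N (x - y).
Proof. by move=> xN yN; rewrite in_powD ?in_powN. Qed.

Lemma in_pow_sub N x y z :
  in_pow N (x - y) -> in_pow N (y - z) -> in_pow N (x - z).
Proof. by move=> xy yz; rewrite -(subrK y x) -addrA in_powD. Qed.

Lemma in_pow_sym N x y : in_pow N (x - y) = in_pow N (y - x).
Proof. by rewrite -in_powN opprB. Qed.

Lemma in_pow_trans N x y : in_pow N (x - y) -> in_pow N y -> in_pow N x.
Proof. by move=> xy yN; rewrite -(subrK y x) in_powD. Qed.

Lemma in_pow_sum (I : Type) (r : seq I) (P : pred I) N (F : I -> K) :
  (forall i, P i -> in_pow N (F i)) -> in_pow N (\sum_(i <- r | P i) F i).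
Proof.
move=> FN; elim/big_ind: _ => //; [exact: in_pow0 | move=> ? ?].
exact: in_powD.
Qed.

Lemma in_powE0 x : in_pow 0 x = (x \in O).
Proof. by rewrite /in_pow expr0 divr1. Qed.

Lemma in_powM N M x y : in_pow N x -> in_pow M y -> in_pow (N + M) (x * y).
Proof.
move=> /in_powP[a aO ->] /in_powP[b bO ->]; apply/in_powP; exists (a * b).
  exact: rpredM.
by rewrite exprD mulrACA.
Qed.

Lemma in_powMl N x y : x \in O -> in_pow N y -> in_pow N (x * y).
Proof. by rewrite -in_powE0; exact: in_powM. Qed.

Lemma in_powMr N x y : in_pow N x -> y \in O -> in_pow N (x * y).
Proof. by rewrite mulrC => *; apply: in_powMl. Qed.

Lemma in_pow_le N M x : (M <= N)%N -> in_pow N x -> in_pow M x.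
Proof.
move=> /subnKC <- /in_powP[y yO ->]; apply/in_powP.
by exists (lam ^+ (N - M) * y); rewrite ?rpredM ?rpredX // exprD mulrA.
Qed.

Lemma in_powO N x : in_pow N x -> x \in O.
Proof. by rewrite -in_powE0; apply: in_pow_le. Qed.

Lemma in_powX N x n : in_pow N x -> in_pow (n * N) (x ^+ n).
Proof.
move=> xN; elim: n => [|n IHn]; first by rewrite in_powE0 rpred1.
by rewrite exprS mulSn in_powM.
Qed.

Lemma p_neq0 : p%:R != 0 :> K.
Proof.
have [c _ E] := lam_ram; apply: contraTneq (lamX_neq0 p.-1) => p0.
by rewrite E p0 oppr0 mul0r eqxx.
Qed.

Lemma lamX_div_p : lam ^+ p.-1 / p%:R \in O.
Proof.
have [c cO ->] := lam_ram; rewrite !mulNr mulrAC divff ?p_neq0 // mul1r.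
by rewrite rpredN rpredD ?rpred1 ?rpredM.
Qed.

Lemma p_in_pow : in_pow p.-1 p%:R.
Proof.
have [c cO E] := lam_ram; apply/in_powP; exists (- (1 + lam * c)^-1).
  by rewrite rpredN unit_1D.
rewrite E mulNr mulrNN mulfK //.
by apply: contraTneq (lamX_neq0 p.-1) => c0; rewrite E c0 mulr0 eqxx.
Qed.

Lemma p_in_pow1 : in_pow 1 p%:R.
Proof.
by apply: in_pow_le p_in_pow; rewrite -ltnS prednK ?prime_gt0 ?prime_gt1.
Qed.

Lemma unit_1D_neq0 c : c \in O -> 1 + lam * c != 0.
Proof.
move=> cO; apply: contraNneq lamV_O => /eqP; rewrite addrC addr_eq0 => /eqP E.
have -> : lam^-1 = - c; last by rewrite rpredN.
by rewrite -[c](mulKf lam_neq0) E mulrN1 opprK.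
Qed.

(** Bezout gives u n = 1 + p v, which has the form 1 + lam c and so is invertible in O. *)
Lemma coprime_inv n : coprime p n -> n%:R^-1 \in O.
Proof.
move=> cpn; have n_gt0 : (0 < n)%N.
  case: n cpn => //; rewrite /coprime gcdn0 => /eqP p1.
  by move: p_pr; rewrite p1.
have [u v E _] := egcdnP p n_gt0.
have {}E : (u * n)%:R = 1 + p%:R * v%:R :> K.
  by rewrite E gcdnC (eqP cpn) natrD natrM mulrC addrC.
have [c cO Ep] := in_powP _ _ p_in_pow1.
have cvO : c * v%:R \in O by rewrite rpredM ?rpred_nat.
rewrite Ep expr1 -mulrA natrM in E.
have := unit_1D_neq0 cvO; rewrite -E mulf_eq0 negb_or => /andP[u0 n0].
have -> : n%:R^-1 = u%:R * (1 + lam * (c * v%:R))^-1 :> K.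
  by rewrite -E invfM mulrA divff // mul1r.
by rewrite rpredM ?rpred_nat ?unit_1D.
Qed.

(** Write i = b p^a with b prime to p: b is a unit of O, and each division by p costs p - 1 powers
    of lam. *)
Lemma in_pow_div_nat N z i : (0 < i)%N -> in_pow N z ->
  (p.-1 * logn p i <= N)%N -> in_pow (N - p.-1 * logn p i) (z / i%:R).
Proof.
move=> i_gt0 /in_powP[y yO ->] leN; apply/in_powP.
have [b cpb Ei] := pfactor_coprime p_pr i_gt0.
have -> : i%:R = b%:R * p%:R ^+ logn p i :> K by rewrite {1}Ei natrM natrX.
set a := logn p i in leN *.
exists (y * b%:R^-1 * (lam ^+ p.-1 / p%:R) ^+ a).
  by rewrite !rpredM ?rpredX ?lamX_div_p ?coprime_inv.
by rewrite -{1}(subnK leN) exprD exprM invfM expr_div_n; ring.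
Qed.

Lemma in_pow_expB_div x y M i : (0 < i)%N -> in_pow 2 x -> in_pow 2 y ->
  in_pow M (x - y) -> in_pow (M + i.-1) ((x ^+ i - y ^+ i) / i%:R).
Proof.
move=> i_gt0 x2 y2 xyM; have lt_i := muln_logn_lt p_pr i_gt0.
(* x^i - y^i is x - y times a form of degree i - 1 in elements of lam^2 O; of the 2 (i-1) powers of
   lam gained, dividing by i costs at most i - 1. *)
apply: (@in_pow_le (M + i.-1 * 2 - p.-1 * logn p i)); first by lia.
apply: in_pow_div_nat => //; last by lia.
rewrite subrXX; apply: in_powM => //; apply: in_pow_sum => j _.
have -> : (i.-1 * 2 = (i.-1 - j) * 2 + j * 2)%N by have := ltn_ord j; lia.
by apply: in_powM; apply: in_powX.
Qed.

(** * Convergence of the logarithm on lam O *)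

Lemma in_pow_log_term x i : (0 < i)%N -> in_pow 1 x ->
  in_pow (i - p.-1 * logn p i) ((-1) ^+ i.-1 * (x ^+ i / i%:R)).
Proof.
move=> i_gt0 x1; apply: in_powMl; first by rewrite rpredX ?rpredN1.
apply: in_pow_div_nat => //; last exact/ltnW/muln_logn_lt.
by have := in_powX i x1; rewrite muln1.
Qed.

Lemma in_pow_log_tail N x i : in_pow 1 x -> (N.*2 + p < i)%N ->
  in_pow N ((-1) ^+ i.-1 * (x ^+ i / i%:R)).
Proof.
move=> x1 lti; have i_gt0 : (0 < i)%N by apply: leq_trans lti.
apply: in_pow_le (in_pow_log_term i_gt0 x1).
have := double_muln_logn_le p_pr i_gt0.
by move: (p.-1 * _)%N => a; lia.
Qed.

Lemma log_sumS x n :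
  log_sum x n.+1 = log_sum x n + (-1) ^+ n * (x ^+ n.+1 / n.+1%:R).
Proof. by rewrite /log_sum big_nat_recr. Qed.

Lemma log_sum_cauchy N x m n : in_pow 1 x -> (N.*2 + p <= m)%N ->
  (m <= n)%N -> in_pow N (log_sum x n - log_sum x m).
Proof.
move=> x1 leNm /subnK <-; elim: (n - m)%N => [|k IHk].
  by rewrite subrr in_pow0.
rewrite addSn log_sumS addrAC in_powD // (@in_pow_log_tail _ _ (k + m).+1) //.
by lia.
Qed.

Lemma lam_cvg_unique u l l' : lam_cvg u l -> lam_cvg u l' -> l = l'.
Proof.
move=> ul ul'; apply/eqP; rewrite -subr_eq0; apply/eqP/sepO => N.
have [[n0 un0] [n1 un1]] := (ul N, ul' N); rewrite -/(in_pow N _).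
apply: (@in_pow_sub _ _ (u (maxn n0 n1))); last exact/un1/leq_maxr.
by rewrite in_pow_sym; apply/un0/leq_maxl.
Qed.

Lemma lam_cvg_in_pow N u l n0 : lam_cvg u l ->
  (forall n, (n0 <= n)%N -> in_pow N (u n)) -> in_pow N l.
Proof.
move=> ul uN; have [n1 un1] := ul N.
apply: (@in_pow_trans _ _ (u (maxn n0 n1))).
  by rewrite in_pow_sym; apply/un1/leq_maxr.
exact/uN/leq_maxl.
Qed.

Lemma lam_cvgB u v l l' : lam_cvg u l -> lam_cvg v l' ->
  lam_cvg (fun n => u n - v n) (l - l').
Proof.
move=> ul vl N; have [[n0 un0] [n1 un1]] := (ul N, vl N).
exists (maxn n0 n1) => n; rewrite geq_max => /andP[le0 le1].
have -> : u n - v n - (l - l') = u n - l - (v n - l') by ring.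
by rewrite in_powB ?un0 ?un1.
Qed.

Lemma lam_cvg_cst l : lam_cvg (fun=> l) l.
Proof. by move=> N; exists 0 => n _; rewrite subrr in_pow0. Qed.

Lemma log_sum_cvg x : in_pow 1 x -> exists l, lam_cvg (log_sum x) l.
Proof.
(* Partial sums from index 2n + p on agree mod lam^n, the rate that [completeO] asks for. *)
move=> x1; pose u n := log_sum x (n.*2 + p).
have u0 : u 0 \in O.
  (* [in_pow_sum] forgets that the sum starts at 1; the index 0 gives 1 / 0 = 0. *)
  apply: (@in_powO 0); apply: in_pow_sum => -[|i] _.
    by rewrite expr0 invr0 mulr0 mulr0 in_pow0.
  exact: in_pow_le (in_pow_log_term (ltn0Sn i) x1).
have uS n : (u n.+1 - u n) / lam ^+ n \in O.
  by apply: log_sum_cauchy; rewrite // doubleS; lia.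
have [l ul] := completeO u0 uS; exists l => N.
exists (N.*2 + p) => n leNn; apply: in_pow_sub (ul N).
exact: log_sum_cauchy.
Qed.

(** * The logarithm maps lam O into lam^2 O *)

(** The residue field is F_p, so this is Fermat's little theorem for a natural number congruent to
    [u]. The sign is 1 for odd p, and -1 = 1 mod 2 for p = 2. *)
Lemma fermat_in_pow u : u \in O -> in_pow 1 (u - (-1) ^+ p.-1 * u ^+ p).
Proof.
move=> uO.
have natp n : (p %| n)%N -> in_pow 1 n%:R.
  by move=> /dvdnP[q ->]; rewrite natrM in_powMl ?rpred_nat ?p_in_pow1.
have [n un] := residue_nat uO; rewrite -(expr1 lam) -/(in_pow 1 _) in un.
have uXn : in_pow 1 (u ^+ p - u).
  apply: (@in_pow_sub _ _ (n%:R ^+ p)).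
    rewrite subrXX in_powMr //; apply: rpred_sum => i _.
    by rewrite rpredM ?rpredX ?rpred_nat.
  apply: (@in_pow_sub _ _ n%:R); last by rewrite in_pow_sym.
  have le_np : (n <= n ^ p)%N.
    have [->|n_gt0] := posnP n; first by [].
    by rewrite -{1}(expn1 n) leq_pexp2l // prime_gt0.
  rewrite -natrX -natrB //; apply: natp.
  by rewrite -eqn_mod_dvd // fermat_little.
have sgnp : in_pow 1 (1 - (-1) ^+ p.-1 : K).
  have [p2|p_odd] := even_prime p_pr.
    have -> : 1 - (-1) ^+ p.-1 = 2%:R :> K by rewrite p2 /=; ring.
    by apply: natp; rewrite p2.
  rewrite -signr_odd -subn1 oddB ?prime_gt0 // p_odd expr0 subrr.
  exact: in_pow0.
have -> : u - (-1) ^+ p.-1 * u ^+ p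
        = (1 - (-1) ^+ p.-1) * u - (-1) ^+ p.-1 * (u ^+ p - u) by ring.
apply: in_powB; first exact: in_powMr.
by apply: in_powMl; rewrite // rpredX ?rpredN1.
Qed.

(** With x = lam u and lam^p / p = - lam (1 + lam c), the sum is lam (u - (-1)^(p-1) u^p) up to a
    multiple of lam^2; Fermat supplies the second factor lam. *)
Lemma log_leading_in_pow2 x : in_pow 1 x ->
  in_pow 2 (x + (-1) ^+ p.-1 * (x ^+ p / p%:R)).
Proof.
move=> /in_powP[u uO ->]; have [c cO Ec] := lam_ram.
have -> : (lam ^+ 1 * u) ^+ p / p%:R = - (1 + lam * c) * lam * u ^+ p.
  rewrite expr1 exprMn -{1}(prednK (prime_gt0 p_pr)) exprS Ec.
  by rewrite -[RHS](mulfK p_neq0); ring.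
have -> : lam ^+ 1 * u + (-1) ^+ p.-1 * (- (1 + lam * c) * lam * u ^+ p)
    = lam ^+ 1 * (u - (-1) ^+ p.-1 * u ^+ p)
      - lam ^+ 2 * ((-1) ^+ p.-1 * c * u ^+ p) by ring.
apply: in_powB.
  apply: (@in_powM 1 1); last exact: fermat_in_pow.
  by apply/in_powP; exists 1; rewrite ?rpred1 ?mulr1.
apply/in_powP; exists ((-1) ^+ p.-1 * c * u ^+ p) => //.
by rewrite !rpredM ?rpredX ?rpredN1.
Qed.

Lemma log_sum_in_pow2 x n : in_pow 1 x -> (p <= n)%N ->
  in_pow 2 (log_sum x n).
Proof.
move=> x1 le_pn; have p_gt1 := prime_gt1 p_pr.
rewrite /log_sum big_ltn ?ltnS ?(leq_trans (ltnW p_gt1)) //.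
rewrite expr0 expr1 divr1 mul1r.
(* The term i = p joins the term i = 1, with which it cancels mod lam^2. *)
rewrite (bigD1_seq p) ?iota_uniq ?mem_index_iota ?p_gt1 //= addrA.
apply: in_powD; first exact: log_leading_in_pow2.
rewrite big_seq_cond; apply: in_pow_sum => i /andP[].
rewrite mem_index_iota => /andP[i_gt1 _] ip.
apply: in_pow_le (in_pow_log_term (ltnW i_gt1) x1).
by have := muln_logn_leB2 p_pr i_gt1 ip; lia.
Qed.

Lemma log_in_pow2 x l : in_pow 1 x -> lam_cvg (log_sum x) l -> in_pow 2 l.
Proof.
by move=> x1 xl; apply: lam_cvg_in_pow xl _ => n; apply: log_sum_in_pow2.
Qed.

(** * Surjectivity onto lam^2 O by successive approximation *)

(** When the argument moves by a multiple of lam^M inside lam^2 O, the i-th term with i >= 2 moves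
    by one of lam^(M+i-1), so the logarithm minus the identity is contracting. *)
Lemma log_contraction M x y l l' : in_pow 2 x -> in_pow 2 y ->
  in_pow M (x - y) -> lam_cvg (log_sum x) l -> lam_cvg (log_sum y) l' ->
  in_pow M.+1 (l - l' - (x - y)).
Proof.
move=> x2 y2 xyM xl yl'.
have cvgd := lam_cvgB (lam_cvgB xl yl') (@lam_cvg_cst (x - y)).
apply: (lam_cvg_in_pow (n0 := 1) cvgd) => n n_gt0.
rewrite /log_sum -sumrB big_ltn ?ltnS // !expr0 !expr1 !divr1 !mul1r.
rewrite addrC addKr.
rewrite big_seq; apply: in_pow_sum => i.
rewrite mem_index_iota => /andP[i_gt1 _].
rewrite -mulrBr -mulrBl in_powMl ?rpredX ?rpredN1 //.
apply: in_pow_le (in_pow_expB_div (ltnW i_gt1) x2 y2 xyM); lia.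
Qed.

Lemma log_surjective y : in_pow 2 y ->
  exists2 x, in_pow 1 x & lam_cvg (log_sum x) y.
Proof.
move=> y2.
have /choice[L LP] x : exists l, in_pow 1 x -> lam_cvg (log_sum x) l.
  have [x1|] := boolP (in_pow 1 x); last by exists 0.
  by have [l xl] := log_sum_cvg x1; exists l.
(* [L] is the logarithm on lam O, with unspecified values elsewhere; a fixed point of [f] solves L x
   = y. *)
pose f x := x + (y - L x); pose s n := iter n f 0.
have s12 n : in_pow 2 (s n) -> in_pow 1 (s n) by apply: in_pow_le.
have sP n : in_pow 2 (s n) /\ in_pow n.+2 (y - L (s n)).
  elim: n => [|n [sn2 yn]].
    split; first exact: in_pow0.
    rewrite in_powB // (log_in_pow2 (in_pow0 1)) //; exact/LP/in_pow0.
  have sSn2 : in_pow 2 (s n.+1).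
    by rewrite /s iterS -/(s n) in_powD //; apply: in_pow_le yn.
  split=> //; have sSn : s n.+1 - s n = y - L (s n).
    by rewrite /s iterS -/(s n) /f addrC addKr.
  have sn_close : in_pow n.+2 (s n.+1 - s n) by rewrite sSn.
  (* The increment s (n+1) - s n is the current error y - L (s n), so the quantity estimated here
     is, up to sign, the next error. *)
  have := log_contraction sSn2 sn2 sn_close
            (LP _ (s12 _ sSn2)) (LP _ (s12 _ sn2)).
  rewrite sSn -in_powN; congr in_pow; ring.
have [l sl] : exists l, forall n, (s n - l) / lam ^+ n \in O.
  apply: completeO => [|n]; first exact: rpred0.
  rewrite /s iterS -/(s n) /f addrC addKr.
  by apply: in_pow_le (sP n).2; lia.
have l2 : in_pow 2 l.
  apply: (@in_pow_trans _ _ (s 2)); last exact: (sP 2).1.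
  by rewrite in_pow_sym; exact: sl.
have l1 : in_pow 1 l by apply: in_pow_le l2.
exists l => //; suff -> : y = L l by apply: LP.
apply/eqP; rewrite -subr_eq0; apply/eqP/sepO => n; rewrite -/(in_pow n _).
(* L (s n) is close to y by the error bound, and close to L l by the contraction. *)
apply: (@in_pow_sub _ _ (L (s n))); first by apply: in_pow_le (sP n).2; lia.
have := log_contraction (sP n).1 l2 (sl n) (LP _ (s12 _ (sP n).1)) (LP _ l1).
move=> /(in_pow_le (leqnSn n)) /in_pow_trans; apply; exact: sl.
Qed.

End LocalLogarithm.

(** * Fractions, and the equation satisfied by zeta - 1 *)

Lemma fraction_num_den (R : idomainType) (x : {fraction R}) :
  exists a b : R, b != 0 /\ x * FracField.tofrac b = FracField.tofrac a.
Proof.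
elim/quotW: x => x; exists (\n_x), (\d_x); split; first exact: denom_ratioP.
unlock FracField.tofrac; rewrite -[LHS]FracField.pi_mul.
apply/eqmodP; rewrite /= FracField.equivfE /FracField.mulf.
by rewrite !numden_Ratio ?mulf_neq0 ?oner_neq0 ?denom_ratioP // !mulr1 mulrC.
Qed.

(** Separates the constant, linear and top terms of the binomial expansion; for a prime exponent the
    middle coefficients are multiples of p. *)
Lemma exprD1_ends (R : comPzRingType) (x : R) q :
  (1 + x) ^+ q.+2 =
    1 + x * (q.+2%:R + x * \sum_(i < q) x ^+ i *+ 'C(q.+2, i.+2) + x ^+ q.+1).
Proof.
rewrite exprDn 2!big_ord_recl big_ord_recr !lift0.
rewrite [nat_of_ord ord0]/= [nat_of_ord ord_max]/=.
rewrite !expr1n bin0 bin1 binn !mul1r expr0 expr1.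
rewrite 2!mulrDr mulr_natr -exprS !addrA.
congr (_ + _ + _ + _).
rewrite !mulr_sumr; apply: eq_bigr => i _.
by rewrite !lift0 expr1n mul1r !exprS !mulrnAr.
Qed.

Lemma unity_root_subr1 (K : fieldType) (x : K) p :
  prime p -> x != 0 -> (1 + x) ^+ p = 1 ->
  x ^+ p.-1 =
    - p%:R * (1 + x * \sum_(i < p.-2) x ^+ i * ('C(p, i.+2) %/ p)%:R).
Proof.
move=> p_pr x0 xp; have := prime_gt1 p_pr.
case: p => [|[|q]] // in p_pr xp * => _; rewrite [q.+2.-1]/= [q.+2.-2]/=.
have binE (i : 'I_q) :
    x ^+ i *+ 'C(q.+2, i.+2) = q.+2%:R * (x ^+ i * ('C(q.+2, i.+2) %/ q.+2)%:R).
  have dvdC : (q.+2 %| 'C(q.+2, i.+2))%N.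
    by rewrite prime_dvd_bin //= !ltnS ltn_ord.
  by rewrite mulrCA -natrM [(q.+2 * _)%N]mulnC divnK // mulr_natr.
move: xp; rewrite exprD1_ends -[RHS]addr0 => /addrI/eqP.
rewrite mulf_eq0 (negPf x0) /= (eq_bigr _ (fun i _ => binE i)).
rewrite -mulr_sumr addrC addr_eq0 => /eqP ->.
by rewrite mulNr; congr (- _); rewrite mulrDr mulr1 mulrCA.
Qed.

(** * The integral closure O of Z_p in k *)

Section PadicIntegralClosure.

Variables (p : nat) (p_pr : prime p) (k : fieldExtType (padic p_pr)).
Local Notation Zp := (padic_int p_pr).
Local Notation iota := (padic_int_in k).

Lemma padic_int_in_is_zmod_morphism : zmod_morphism iota.
Proof. by move=> a b; rewrite /padic_int_in rmorphB scalerBl. Qed.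

Lemma padic_int_in_is_monoid_morphism : monoid_morphism iota.
Proof.
split; first by rewrite /padic_int_in rmorph1 scale1r.
by move=> a b; rewrite /padic_int_in rmorphM -scalerAl mul1r scalerA.
Qed.

HB.instance Definition _ := GRing.isZmodMorphism.Build Zp k iota
  padic_int_in_is_zmod_morphism.
HB.instance Definition _ := GRing.isMonoidMorphism.Build Zp k iota
  padic_int_in_is_monoid_morphism.

Lemma padic_int_in_inj : injective iota.
Proof.
move=> a b /eqP; rewrite -subr_eq0 -rmorphB /padic_int_in scaler_eq0 oner_eq0.
by rewrite orbF tofrac_eq0 subr_eq0 => /eqP.
Qed.

(** A boolean form of [ring_of_integers], able to carry the subring structure. *)
Definition Oint : {pred k} := fun x => `[< ring_of_integers k x >].

Lemma OintP x : reflect (ring_of_integers k x) (x \in Oint).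
Proof. exact: asboolP. Qed.

Lemma Oint_subring : subring_closed Oint.
Proof.
split; first by apply/OintP; exact: (integral1 iota).
  by move=> x y /OintP xO /OintP yO; apply/OintP; exact: (integral_sub xO yO).
by move=> x y /OintP xO /OintP yO; apply/OintP; exact: (integral_mul xO yO).
Qed.

HB.instance Definition _ := GRing.isSubringClosed.Build k Oint Oint_subring.

Lemma padic_int_in_Oint a : iota a \in Oint.
Proof. by apply/OintP; exact: (integral_id iota). Qed.

Lemma pK_neq0 : p%:R != 0 :> k.
Proof.
rewrite -(rmorph_nat iota) -(rmorph0 iota) (inj_eq padic_int_in_inj).
exact: padic_natr_neq0.
Qed.

(* Homogenizing a monic equation f of a at p: the value p^d f(1/p), a unit
   of Z_p, equals p^d (f(1/p) - f(a)), a multiple of 1 - p a. *)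
Lemma Oint_1Bp_dvd_unit a : a \in Oint ->
  exists w h, [/\ w != 0, h \in Oint, iota w^-1 \in Oint,
    iota w * iota w^-1 = 1 & iota w = (1 - p%:R * a) * h].
Proof.
move=> aO; have /OintP[f f_mon fa] := aO.
have [d Ed] : exists d, size f = d.+1.
  by exists (size f).-1; rewrite prednK // lt0n size_poly_eq0 monic_neq0.
have f_d : f`_d = 1 by have /monicP := f_mon; rewrite lead_coefE Ed.
pose w : Zp := \sum_(i < d.+1) f`_i * p%:R ^+ (d - i).
have w0 : residue w 0 = 1.
  rewrite /w big_ord_recr residueD [nat_of_ord ord_max]/= f_d subnn mulr1.
  rewrite -[RHS]add0r; congr (_ + _).
  apply: (big_ind (fun x => residue x 0 = 0)) => // [x y x0 y0|i _].
    by rewrite residueD x0 y0 addr0.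
  by rewrite residueM residue_pX ?mulr0 //= subn_gt0 ltn_ord.
have wu : w \is a GRing.unit by apply: padic_unit_residue; rewrite w0 oner_eq0.
exists w, (\sum_(i < d.+1) iota (f`_i) * p%:R ^+ (d - i) *
            \sum_(j < i) (p%:R * a) ^+ j).
split.
- by apply: contraTneq wu => ->; rewrite unitr0.
- apply: rpred_sum => i _; rewrite !rpredM ?padic_int_in_Oint ?rpredX //.
    exact: rpred_nat.
  by apply: rpred_sum => j _; rewrite rpredX ?rpredM ?rpred_nat.
- exact: padic_int_in_Oint.
- by rewrite -rmorphM mulrV // rmorph1.
have E : \sum_(i < d.+1) iota f`_i * p%:R ^+ (d - i) * (p%:R * a) ^+ i = 0.
  transitivity (p%:R ^+ d * (map_poly iota f).[a]); last first.
    by rewrite (rootP fa) mulr0.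
  rewrite (@horner_coef_wide _ d.+1); last by rewrite -Ed size_poly.
  rewrite mulr_sumr; apply: eq_bigr => i _; rewrite coef_map exprMn.
  have -> : p%:R ^+ d = p%:R ^+ (d - i) * p%:R ^+ i :> k.
    by rewrite -exprD subnK ?leq_ord.
  by rewrite /=; ring.
rewrite rmorph_sum -[LHS]subr0 -[X in _ - X]E -sumrB mulr_sumr.
apply: eq_bigr => i _; rewrite rmorphM rmorphXn rmorph_nat.
rewrite -[X in X - _]mulr1 -mulrBr -opprB subrX1 -mulNr opprB; ring.
Qed.

Lemma Oint_1Bp_neq0 a : a \in Oint -> 1 - p%:R * a != 0.
Proof.
move=> /Oint_1Bp_dvd_unit[w [h [w0 _ _ _ E]]].
apply: contraNneq w0 => a0; move: E; rewrite a0 mul0r => /eqP.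
by rewrite -(rmorph0 iota) (inj_eq padic_int_in_inj).
Qed.

Lemma Oint_1Bp_inv a : a \in Oint -> (1 - p%:R * a)^-1 \in Oint.
Proof.
move=> aO; have [w [h [w0 hO wO ww E]]] := Oint_1Bp_dvd_unit aO.
suff -> : (1 - p%:R * a)^-1 = h * iota w^-1 by rewrite rpredM.
apply: (mulfI (Oint_1Bp_neq0 aO)).
by rewrite mulrA -E ww divff // Oint_1Bp_neq0.
Qed.

(** Taking a = 1/p would make 1 - p a vanish, although it divides a unit of Z_p. *)
Lemma p_inv_Oint : p%:R^-1 \notin Oint.
Proof.
by apply/negP => /Oint_1Bp_neq0; rewrite divff ?pK_neq0 // subrr eqxx.
Qed.

(** * The order Z_p[lam] and its equality with O *)

Variable zeta : k.
Hypothesis zeta_prim : p.-primitive_root zeta.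
Hypothesis k_gen : <<1; zeta>>%VS = {:k}%VS.

Local Notation lam := (zeta - 1).

(** The order Z_p[lam] = Z_p[zeta], as values of polynomials; [Oint_Zp_lam] shows that it contains
    O. *)
Definition Zp_lam : {pred k} :=
  fun x => `[< exists q : {poly Zp}, x = (map_poly iota q).[lam] >].

Lemma Zp_lamP x :
  reflect (exists q : {poly Zp}, x = (map_poly iota q).[lam]) (x \in Zp_lam).
Proof. exact: asboolP. Qed.

Lemma Zp_lam_subring : subring_closed Zp_lam.
Proof.
split; first by apply/Zp_lamP; exists 1; rewrite rmorph1 hornerC.
  move=> x y /Zp_lamP[q ->] /Zp_lamP[r ->]; apply/Zp_lamP; exists (q - r).
  by rewrite rmorphB /= hornerD hornerN.
move=> x y /Zp_lamP[q ->] /Zp_lamP[r ->]; apply/Zp_lamP; exists (q * r).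
by rewrite rmorphM /= hornerM.
Qed.

HB.instance Definition _ := GRing.isSubringClosed.Build k Zp_lam Zp_lam_subring.

Lemma padic_int_in_Zp_lam a : iota a \in Zp_lam.
Proof. by apply/Zp_lamP; exists a%:P; rewrite map_polyC hornerC. Qed.

Lemma lam_Zp_lam : lam \in Zp_lam.
Proof. by apply/Zp_lamP; exists 'X; rewrite map_polyX hornerX. Qed.

Lemma lam_Oint : lam \in Oint.
Proof.
rewrite rpredB ?rpred1 //; apply/OintP; exists ('X^p - 1).
  by rewrite -[1]/(1%:P) monicXnsubC ?prime_gt0.
rewrite rmorphB rmorph1 /= map_polyXn /root hornerD hornerN hornerXn hornerC.
by rewrite prim_expr_order // subrr.
Qed.

Lemma lam_cyclo_neq0 : lam != 0.
Proof.
rewrite subr_eq0; apply/eqP => z1; have := prim_order_dvd zeta_prim 1.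
by rewrite z1 expr1 eqxx dvdn1 => /eqP p1; move: (prime_gt1 p_pr); rewrite p1.
Qed.

Lemma lamX_cyclo :
  exists2 c, c \in Zp_lam & lam ^+ p.-1 = - p%:R * (1 + lam * c).
Proof.
have zp : (1 + lam) ^+ p = 1 by rewrite addrC subrK prim_expr_order.
rewrite (unity_root_subr1 p_pr lam_cyclo_neq0 zp); eexists; last by [].
by apply: rpred_sum => i _; rewrite rpredM ?rpredX ?lam_Zp_lam ?rpred_nat.
Qed.

Lemma p_lam_Zp_lam : exists2 s, s \in Zp_lam & p%:R = lam * s.
Proof.
have [c cS Ec] := lamX_cyclo.
exists (- (lam ^+ p.-2 + p%:R * c)).
  by rewrite rpredN rpredD ?rpredX ?rpredM ?rpred_nat ?lam_Zp_lam.
have E : lam ^+ p.-1 = lam * lam ^+ p.-2.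
  by rewrite -exprS prednK // -ltnS prednK ?prime_gt1 ?prime_gt0.
rewrite mulrN mulrDr -E Ec; ring.
Qed.

Lemma Zp_lam_Oint x : x \in Zp_lam -> x \in Oint.
Proof.
move=> /Zp_lamP[q ->]; rewrite horner_coef; apply: rpred_sum => i _.
by rewrite coef_map rpredM ?rpredX ?lam_Oint ?padic_int_in_Oint.
Qed.

(** p^-1 is an integral multiple of lam^-(p-1), so integrality of lam^-1 would force that of
    p^-1. *)
Lemma lamV_Oint : lam^-1 \notin Oint.
Proof.
have [c /Zp_lam_Oint cO Ec] := lamX_cyclo; apply: contra p_inv_Oint => lO.
suff -> : p%:R^-1 = - (1 + lam * c) * lam^-1 ^+ p.-1.
  by rewrite rpredM ?rpredX // rpredN rpredD ?rpred1 ?rpredM ?lam_Oint.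
apply: (mulfI pK_neq0); rewrite divff ?pK_neq0 // mulrA mulrN -mulNr -Ec.
by rewrite exprVn divff // expf_neq0 // lam_cyclo_neq0.
Qed.

Lemma Zp_lam_decomp x : x \in Zp_lam ->
  exists b, exists2 c, c \in Zp_lam & x = iota b + lam * c.
Proof.
move=> /Zp_lamP[q ->]; elim/poly_ind: q => [|q b _].
  by exists 0, 0; rewrite ?rpred0 // !rmorph0 horner0 mulr0 addr0.
exists b, (map_poly iota q).[lam]; first by apply/Zp_lamP; exists q.
rewrite rmorphD rmorphM /= map_polyX map_polyC hornerD hornerM hornerX hornerC.
by rewrite addrC mulrC.
Qed.

(** Z_p[lam] is saturated at lam. In lam x = b + lam c, either p divides b and lam cancels, or b is
    a unit and lam^-1 = b^-1 (x - c) is integral, a contradiction. *)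
Lemma Zp_lam_mul_lam x : x \in Oint -> lam * x \in Zp_lam -> x \in Zp_lam.
Proof.
move=> xO /Zp_lam_decomp[b [c cS Ex]]; have l0 := lam_cyclo_neq0.
have [b0|b0] := eqVneq (residue b 0) 0.
  have [b' Eb] := residue_eq0_dvd b0; have [s sS Es] := p_lam_Zp_lam.
  suff -> : x = s * iota b' + c by rewrite rpredD ?rpredM ?padic_int_in_Zp_lam.
  by apply: (mulfI l0); rewrite Ex Eb rmorphM rmorph_nat Es mulrDr mulrA.
have bu := padic_unit_residue b0.
case/negP: lamV_Oint; suff -> : lam^-1 = iota b^-1 * (x - c).
  by rewrite rpredM ?padic_int_in_Oint ?rpredB // Zp_lam_Oint.
apply: (mulfI l0); rewrite divff // mulrCA mulrBr Ex addrK -rmorphM.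
by rewrite mulVr // rmorph1.
Qed.

Lemma Zp_lam_mul_lamX n x :
  x \in Oint -> lam ^+ n * x \in Zp_lam -> x \in Zp_lam.
Proof.
move=> xO; elim: n => [|n IHn]; first by rewrite mul1r.
rewrite exprS -mulrA => /Zp_lam_mul_lam Sx; apply/IHn/Sx.
by rewrite rpredM ?rpredX ?lam_Oint.
Qed.

(** lam^((p-1) n) is a multiple of p^n in Z_p[lam], which reduces saturation at p to saturation at
    lam. *)
Lemma Zp_lam_mul_p n x : x \in Oint -> p%:R ^+ n * x \in Zp_lam -> x \in Zp_lam.
Proof.
move=> xO Sx; have [c cS Ec] := lamX_cyclo.
apply: (@Zp_lam_mul_lamX (p.-1 * n)) => //.
rewrite exprM Ec mulNr -mulrN exprMn mulrAC mulrC rpredM // rpredX //.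
by rewrite rpredN rpredD ?rpred1 ?rpredM ?lam_Zp_lam.
Qed.

(** By [k_gen], x is a polynomial in zeta over Q_p, and the denominators of its coefficients divide
    powers of p. *)
Lemma pX_mul_Zp_lam x : exists s, p%:R ^+ s * x \in Zp_lam.
Proof.
have : x \in <<1; zeta>>%VS by rewrite k_gen memvf.
case/Fadjoin_polyP => q qK ->; rewrite horner_coef.
elim/big_ind: _ => [|y z [s ys] [t zt]|i _].
- by exists 0; rewrite mulr0 rpred0.
- exists (s + t)%N; rewrite mulrDr exprD -{1}[_ ^+ s * _]mulrC -!mulrA.
  by rewrite rpredD // rpredM ?rpredX ?rpred_nat.
have /vlineP[a ->] := polyOverP qK i.
have [b [d [d0 Ea]]] := fraction_num_den a.
have [s [e Es]] := padic_int_dvd_pX d0; exists s.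
have -> : p%:R ^+ s * (a *: 1 * zeta ^+ i) = iota (b * e) * zeta ^+ i.
  rewrite mulrA; congr (_ * _).
  rewrite -(rmorph_nat iota) -rmorphXn -Es /= /padic_int_in.
  by rewrite -scalerAl mul1r scalerA mulrC !tofracM mulrA Ea.
have zS : zeta \in Zp_lam by rewrite -(subrK 1 zeta) rpredD ?rpred1 ?lam_Zp_lam.
by rewrite rpredM ?rpredX ?padic_int_in_Zp_lam.
Qed.

(** Some power of p brings x into Z_p[lam], and saturation removes that power. *)
Lemma Oint_Zp_lam x : x \in Oint -> x \in Zp_lam.
Proof. by move=> xO; have [s /Zp_lam_mul_p] := pX_mul_Zp_lam x; apply. Qed.

(** * Hypotheses of the local logarithm for O: units, residue field, separation, completeness *)

Lemma lamX_cyclo_Oint :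
  exists2 c, c \in Oint & lam ^+ p.-1 = - p%:R * (1 + lam * c).
Proof. by have [c /Zp_lam_Oint cO Ec] := lamX_cyclo; exists c. Qed.

Lemma lam_unit_1D c : c \in Oint -> (1 + lam * c)^-1 \in Oint.
Proof.
move=> cO; have [d dO Ed] := lamX_cyclo_Oint.
(* Chosen so that p a = (- lam c)^(p-1): by the geometric sum, 1 + lam c divides 1 - p a, which is a
   unit of O. *)
pose a := - (1 + lam * d) * (- c) ^+ p.-1.
have aO : a \in Oint.
  rewrite rpredM ?rpredX ?rpredN // rpredD ?rpred1 ?rpredM ?lam_Oint //.
pose g := \sum_(i < p.-1) (- (lam * c)) ^+ i.
have E : 1 - p%:R * a = (1 + lam * c) * g.
  have -> : p%:R * a = (- (lam * c)) ^+ p.-1.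
    by rewrite -mulrN exprMn Ed /a; ring.
  by rewrite -opprB subrX1 -mulNr opprB opprK.
have := Oint_1Bp_neq0 aO; rewrite E mulf_eq0 negb_or => /andP[c0 g0].
have -> : (1 + lam * c)^-1 = g * (1 - p%:R * a)^-1.
  by rewrite E invfM mulrCA divff // mulr1.
rewrite rpredM ?Oint_1Bp_inv //; apply: rpred_sum => i _.
by rewrite rpredX // rpredN rpredM ?lam_Oint.
Qed.

(** The residue mod p of the constant coefficient serves, because p is a multiple of lam. *)
Lemma Oint_residue_nat x :
  x \in Oint -> exists n : nat, (x - n%:R) / lam \in Oint.
Proof.
move=> /Oint_Zp_lam/Zp_lam_decomp[b [c /Zp_lam_Oint cO ->]].
have l0 := lam_cyclo_neq0.
have [s /Zp_lam_Oint sO Es] := p_lam_Zp_lam.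
pose n : nat := residue b 0; exists n.
have [|y Ey] := @residue_eq0_dvd _ p_pr (b - n%:R).
  by rewrite residueD residueN residue_natr natr_Zp subrr.
have -> : iota b + lam * c - n%:R = lam * (s * iota y + c).
  rewrite addrAC mulrDr; congr (_ + _); rewrite -(rmorph_nat iota) -rmorphB Ey.
  by rewrite rmorphM rmorph_nat Es mulrA.
by rewrite mulrAC divff // mul1r rpredD ?rpredM ?padic_int_in_Oint.
Qed.

Lemma pX_lamX n : exists2 e, e \in Oint & lam ^+ (p.-1 * n) = p%:R ^+ n * e.
Proof.
have [c cO Ec] := lamX_cyclo_Oint; exists ((- (1 + lam * c)) ^+ n).
  by rewrite rpredX // rpredN rpredD ?rpred1 ?rpredM ?lam_Oint.
by rewrite exprM Ec mulNr -mulrN exprMn.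
Qed.

Lemma Oint_separated x : (forall N, x / lam ^+ N \in Oint) -> x = 0.
Proof.
move=> xO; apply: contrapT => /eqP x0; have l0 := lam_cyclo_neq0.
have [s /Zp_lam_Oint sO] := pX_mul_Zp_lam x^-1.
have [e eO Ee] := pX_lamX s.
case/negP: lamV_Oint.
(* p^s / x is integral, while x is divisible by lam^((p-1) s + 1), one power of lam more than p^s
   accounts for. *)
suff -> : lam^-1 = e * (p%:R ^+ s * x^-1 * (x / lam ^+ (p.-1 * s).+1)).
  by apply: (rpredM eO); apply: (rpredM sO).
have -> : e * (p%:R ^+ s * x^-1 * (x / lam ^+ (p.-1 * s).+1)) =
    p%:R ^+ s * e * (x^-1 * x) / lam ^+ (p.-1 * s).+1 by ring.
rewrite -Ee mulVf // mulr1.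
by rewrite exprSr invfM mulrA divff ?mul1r // expf_neq0.
Qed.

(** Comes from reducing a polynomial in zeta modulo the monic X^p - 1. The p powers generate O over
    Z_p but are not independent, their sum being 0. *)
Lemma Oint_basis x : x \in Oint ->
  exists a : nat -> Zp, x = \sum_(i < p) iota (a i) * zeta ^+ i.
Proof.
move=> /Oint_Zp_lam/Zp_lamP[q ->].
have {q}[q ->] : exists q' : {poly Zp},
    (map_poly iota q).[lam] = (map_poly iota q').[zeta].
  exists (q \Po ('X - 1)); rewrite map_comp_poly horner_comp rmorphB /=.
  by rewrite map_polyX rmorph1 hornerD hornerN hornerX hornerC.
have p_gt0 := prime_gt0 p_pr.
have M_mon : ('X^p - 1%:P : {poly Zp}) \is monic by rewrite monicXnsubC.
have [r rs Eq] : exists2 r : {poly Zp}, (size r <= p)%N &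
    (map_poly iota q).[zeta] = (map_poly iota r).[zeta].
  exists (Pdiv.Ring.rmodp q ('X^p - 1%:P)).
    rewrite -ltnS -(size_XnsubC (1 : Zp) p_gt0).
    by rewrite Pdiv.Ring.ltn_rmodpN0 ?monic_neq0.
  rewrite {1}(Pdiv.RingMonic.rdivp_eq M_mon q) rmorphD rmorphM /=.
  have Mz : (map_poly iota ('X^p - 1%:P)).[zeta] = 0.
    rewrite rmorphB rmorph1 /= map_polyXn hornerD hornerN hornerXn hornerC.
    by rewrite (prim_expr_order zeta_prim) subrr.
  by rewrite hornerD hornerM Mz mulr0 add0r.
exists (fun i => r`_i); rewrite Eq (@horner_coef_wide _ p).
  by apply: eq_bigr => i _; rewrite coef_map.
exact: leq_trans (size_poly _ _) rs.
Qed.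

Lemma Oint_complete (u : nat -> k) : u 0 \in Oint ->
  (forall n, (u n.+1 - u n) / lam ^+ n \in Oint) ->
  exists l, forall n, (u n - l) / lam ^+ n \in Oint.
Proof.
move=> u0 uS; have l0 := lam_cyclo_neq0.
have uB n m : (n <= m)%N -> (u m - u n) / lam ^+ n \in Oint.
  move=> /subnK <-; elim: (m - n)%N => [|j IHj].
    by rewrite subrr mul0r rpred0.
  have := uS (j + n)%N; rewrite -/(in_pow Oint lam _ _).
  move/(in_pow_le lam_Oint lamV_Oint (leq_addl j n)) => uj.
  exact: in_pow_sub uj IHj.
(* Along this subsequence the increments are divisible by p^n, so their coordinates form series
   converging in Z_p. *)
pose v n := u (p.-1 * n)%N.
have vS n : exists a : nat -> Zp,
    v n.+1 - v n = p%:R ^+ n * \sum_(i < p) iota (a i) * zeta ^+ i.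
  have [e eO Ee] := pX_lamX n.
  have le_v : (p.-1 * n <= p.-1 * n.+1)%N by rewrite leq_mul2l leqnSn orbT.
  have [a Ea] := Oint_basis (rpredM (uB _ _ le_v) eO); exists a.
  by rewrite -Ea mulrCA -Ee divfK // expf_neq0.
have {vS}/choice[a aP] := vS.
have /choice[s sP] i := @padic_int_series _ p_pr (fun j => a j i).
have vE N : v N =
    v 0 + \sum_(i < p) iota (\sum_(j < N) p%:R ^+ j * a j i) * zeta ^+ i.
  elim: N => [|N IHN].
    rewrite big1 ?addr0 // => i _; by rewrite big_ord0 rmorph0 mul0r.
  rewrite -[LHS](subrK (v N)) aP IHN addrC -addrA; congr (_ + _).
  rewrite mulr_sumr -big_split; apply: eq_bigr => i _ /=.
  by rewrite big_ord_recr rmorphD rmorphM rmorphXn rmorph_nat mulrDl mulrA.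
exists (v 0 + \sum_(i < p) iota (s i) * zeta ^+ i) => N.
(* u N and v N agree mod lam^N because N <= (p-1) N. *)
rewrite -/(in_pow Oint lam _ _); apply: (@in_pow_sub _ _ _ _ _ (v N)).
  rewrite in_pow_sym; apply: uB.
  rewrite leq_pmull // -ltnS prednK ?prime_gt0 //.
  exact: prime_gt1.
rewrite in_pow_sym (vE N) opprD addrACA subrr add0r -sumrB.
apply: in_pow_sum => i _; rewrite -mulrBl -rmorphB.
have [r ->] := sP i N; rewrite rmorphM rmorphXn rmorph_nat.
have zO : zeta \in Oint by rewrite -(subrK 1 zeta) rpredD ?rpred1 ?lam_Oint.
have [q /Zp_lam_Oint qO Eq] := p_lam_Zp_lam.
apply/(in_powP lamV_Oint); exists (q ^+ N * iota r * zeta ^+ i).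
  by rewrite !rpredM ?rpredX ?padic_int_in_Oint.
by rewrite Eq exprMn !mulrA.
Qed.

End PadicIntegralClosure.

Arguments Oint {p p_pr} k.

(** * The ideals m and m^2, the topology and the group law in terms of lam *)

Section MaximalIdeal.

Variables (p : nat) (p_pr : prime p) (k : fieldExtType (padic p_pr)).
Variables (zeta : k) (m : set k).
Hypothesis zeta_prim : p.-primitive_root zeta.
Hypothesis k_gen : <<1; zeta>>%VS = {:k}%VS.
Hypothesis m_max : maximal_ideal (ring_of_integers k) m.

Local Notation O := (Oint k).
Local Notation lam := (zeta - 1).
Local Notation lamV_O := (lamV_Oint zeta_prim).

(** An element of O outside lam O is congruent mod lam to a natural number prime to p, hence a unit,
    so m lies in lam O; since lam O is a proper ideal, maximality gives equality. *)
Lemma maximal_ideal_lam x : m x <-> in_pow O lam 1 x.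
Proof.
have [[mO m0 mD mM] m_neq m_maxl] := m_max.
have lamP := in_powP lamV_O; have lO := lam_Oint zeta_prim.
have ideal1 : is_ideal (ring_of_integers k) [set y | in_pow O lam 1 y].
  split=> /= [y /(in_powO lO lamV_O)/OintP //||y z|a y /OintP aO].
  - exact: in_pow0.
  - by move=> y1 z1; exact: (in_powD y1 z1).
  - by move=> y1; exact: (in_powMl lamV_O aO y1).
have sub1 : m `<=` [set y | in_pow O lam 1 y].
  move=> y my /=; apply: contrapT => /negP y1; apply: m_neq.
  apply/seteqP; split=> // z /OintP zO.
  have yO : y \in O by apply/OintP/mO.
  suff yVO : y^-1 \in O.
    have -> : z = z * y^-1 * y.
      rewrite mulfVK //; apply: contraNneq y1 => ->; exact: in_pow0.
    by apply: mM => //; apply/OintP/rpredM.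
  have [n yn] := Oint_residue_nat zeta_prim k_gen yO.
  rewrite -(expr1 lam) -/(in_pow O lam 1 _) in yn.
  have cpn : coprime p n.
    rewrite prime_coprime //; apply: contra y1 => /dvdnP[q Eq].
    have p1 : in_pow O lam 1 p%:R.
      have [s /(Zp_lam_Oint zeta_prim) sO Es] := p_lam_Zp_lam zeta_prim.
      by apply/lamP; exists s; rewrite ?expr1.
    rewrite -(subrK n%:R y) in_powD // Eq natrM.
    exact: (in_powMl lamV_O (rpred_nat O q) p1).
  have nVO := coprime_inv p_pr lO lamV_O (lamX_cyclo_Oint zeta_prim)
                (lam_unit_1D zeta_prim) cpn.
  have n0 : n%:R != 0 :> k.
    apply: contraNneq y1 => n0; by rewrite n0 subr0 in yn.
  have /lamP[c cO Ec] := in_powMl lamV_O nVO yn.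
  have -> : y = n%:R * (1 + lam * c).
    by rewrite -(expr1 lam) -Ec; field.
  by rewrite invfM rpredM // lam_unit_1D.
case: (m_maxl _ ideal1 sub1) => [<-|E] //.
have : [set y | in_pow O lam 1 y] 1 by rewrite E; apply/OintP/rpred1.
by rewrite /= /in_pow expr1 mul1r (negPf lamV_O).
Qed.

Lemma ideal_sqr_lam x : ideal_sqr m x <-> in_pow O lam 2 x.
Proof.
have lO := lam_Oint zeta_prim.
split=> [[n [y [z [my mz ->]]]]|/(in_powP lamV_O)[y yO ->]].
  apply: in_pow_sum => i _.
  by apply: (in_powM lamV_O (N := 1) (M := 1)); apply/maximal_ideal_lam.
exists 1, (fun=> lam), (fun=> lam * y); split.
- move=> i; apply/maximal_ideal_lam/(in_powP lamV_O).
  by exists 1; rewrite ?rpred1 ?mulr1.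
- by move=> i; apply/maximal_ideal_lam/(in_powP lamV_O); exists y.
- by rewrite big_ord1 mulrA.
Qed.

(** The two filtrations are cofinal: p^N lies in lam^N O, and lam^((p-1) N) in p^N O. *)
Lemma padic_cvg_lam (u : nat -> k) l : padic_cvg u l <-> lam_cvg O lam u l.
Proof.
have lO := lam_Oint zeta_prim.
split=> ul N; last first.
  have [n0 un] := ul (p.-1 * N)%N; exists n0 => n le_n.
  have [y yO ->] := in_powP lamV_O _ _ (un n le_n).
  have [e eO ->] := pX_lamX zeta_prim N.
  by exists (e * y); [apply/OintP/rpredM | rewrite mulrA].
have [n0 un] := ul N; exists n0 => n /un[y /OintP yO <-].
have [s /(Zp_lam_Oint zeta_prim) sO ->] := p_lam_Zp_lam zeta_prim.
apply/(in_powP lamV_O); exists (s ^+ N * y); first by rewrite rpredM ?rpredX.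
by rewrite exprMn mulrA.
Qed.

(** The law is (1 + x) (1 + y) - 1, so the inverse of x is -x / (1 + x), where 1 + x is a unit of
    O. *)
Lemma multiplicative_fgl_group N : (0 < N)%N ->
  is_group (@multiplicative_fgl k) [set x | in_pow O lam N x].
Proof.
have lO := lam_Oint zeta_prim.
move=> N_gt0; split=> /= [x y xN yN|x y z _ _ _|].
- rewrite /multiplicative_fgl in_powD ?in_powD //.
  exact: (in_powMl lamV_O (in_powO lO lamV_O xN) yN).
- by rewrite /multiplicative_fgl; ring.
exists 0; first exact: in_pow0.
split=> x xN.
  by rewrite /multiplicative_fgl mulr0 mul0r !addr0 add0r.
have [c cO Ec] := in_powP lamV_O _ _ (in_pow_le lO lamV_O N_gt0 xN).
have xVO : (1 + x)^-1 \in O by rewrite Ec expr1 lam_unit_1D.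
have x0 : 1 + x != 0 by rewrite Ec expr1 (unit_1D_neq0 lamV_O).
exists (- x * (1 + x)^-1).
  by apply: (in_powMr lamV_O) => //; rewrite in_powN.
by rewrite /multiplicative_fgl; split; field.
Qed.

Lemma padic_log_cvg x : in_pow O lam 1 x ->
  lam_cvg O lam (log_sum x) (padic_log (1 + x)).
Proof.
move=> x1.
have [l xl] := log_sum_cvg p_pr (lam_Oint zeta_prim) lamV_O
  (lamX_cyclo_Oint zeta_prim) (lam_unit_1D zeta_prim)
  (Oint_complete zeta_prim k_gen) x1.
rewrite /padic_log (_ : 1 + x - 1 = x); last by rewrite addrC addKr.
(* The limit [l] shows that [xget] does not fall back on its default value. *)
by apply/padic_cvg_lam; case: xgetP => [y _ //|/(_ l)[]]; apply/padic_cvg_lam.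
Qed.

End MaximalIdeal.

(** * The logarithm of 1 + m and the subgroup m^2 *)

Theorem theorem2p1 (p : nat) (p_pr : prime p)
    (k : fieldExtType (padic p_pr)) (zeta : k)
    (zeta_prim : p.-primitive_root zeta)
    (k_gen : <<1; zeta>>%VS = {:k}%VS)
    (m : set k) (m_max : maximal_ideal (ring_of_integers k) m)
    (pi : k) (pi_unif : m = principal_ideal (ring_of_integers k) pi) :
  [/\ forall x, m x ->
        padic_cvg (log_partial_sum x) (padic_log (1 + x)),
      [set padic_log (1 + x) | x in m] = ideal_sqr m &
      is_subgroup (@multiplicative_fgl k) (ideal_sqr m) m].
Proof.
have lO := lam_Oint zeta_prim; have lVO := lamV_Oint zeta_prim.
have mE := maximal_ideal_lam zeta_prim k_gen m_max.
have m2E := ideal_sqr_lam zeta_prim k_gen m_max.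
have logP x (mx : m x) := padic_log_cvg zeta_prim k_gen ((mE x).1 mx).
have ram := lamX_cyclo_Oint zeta_prim; have unit1 := lam_unit_1D zeta_prim.
have resid := Oint_residue_nat zeta_prim k_gen.
have sepO := Oint_separated zeta_prim k_gen.
have complO := Oint_complete zeta_prim k_gen.
have mS : m = [set x | in_pow (Oint k) (zeta - 1) 1 x].
  by apply/seteqP; split=> x /mE.
have m2S : ideal_sqr m = [set x | in_pow (Oint k) (zeta - 1) 2 x].
  by apply/seteqP; split=> x /m2E.
split.
- by move=> x /logP xl; apply/(padic_cvg_lam zeta_prim).
- rewrite m2S; apply/seteqP; split=> [_ [x mx <-]|y y2] /=.
    exact: (log_in_pow2 p_pr lO lVO ram unit1 resid ((mE x).1 mx) (logP x mx)).
  (* The series at the preimage tends both to [y] and to [padic_log (1 + x)]; limits are unique. *)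
  have [x /mE mx xy] :=
    log_surjective p_pr lO lVO ram unit1 resid sepO complO y2.
  by exists x => //; apply: (lam_cvg_unique sepO (logP x mx) xy).
- split; rewrite ?m2S ?mS; try exact: multiplicative_fgl_group.
  by move=> x; apply: (in_pow_le lO lVO).
Qed.
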